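(* Let $\Pi$ be a probability measure on $\mathbb{R}^d$ with density $\pi$ with respect to Lebesgue measure, with $\pi>0$ exactly on its support set $\Theta\subseteq\mathbb{R}^d$. Let $h\in(0,\infty)$, let $C$ be a positive-definite, symmetric $d\times d$ matrix, and let $\mu:\mathbb{R}^d\to\mathbb{R}^d$. Let $\theta_0\in\Theta$ and let the proposal distribution be $N(\mu(\theta),hC)$. Then the Metropolis-Hastings acceptance probability satisfies $$A(\theta_0)\ \le\ \frac{1}{\pi(\theta_0)(2\pi h)^{d/2}\det(C)^{1/2}}.$$
   Context: In $\pi(\theta_0)$, $\pi$ is the target density; in $(2\pi h)^{d/2}$, $\pi$ is the usual constant. With $q(\theta,\cdot)$ the Lebesgue density of $N(\mu(\theta),hC)$, the Metropolis-Hastings acceptance function is $a(\theta,\theta')=\frac{\pi(\theta')q(\theta',\theta)}{\pi(\theta)q(\theta,\theta')}\wedge1$ if $\pi(\theta)q(\theta,\theta')>0$ and $a(\theta,\theta')=1$ otherwise, and the acceptance probability is $A(\theta)=\int a(\theta,\theta')q(\theta,\theta')\,d\theta'$. *)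

(* Defs.v *)
From HB Require Import structures.
From mathcomp Require Import all_boot all_order all_algebra.
From mathcomp Require Import all_classical all_reals all_analysis.

Set Implicit Arguments.
Unset Strict Implicit.
Unset Printing Implicit Defensive.

Import Order.TTheory GRing.Theory Num.Theory.
Import numFieldNormedType.Exports.

Local Open Scope classical_set_scope.
Local Open Scope ring_scope.

Section lebesgue_tuple_cons.
Context {R : realType} {n : nat}.
Variable m : {measure set (n.-tuple R) -> \bar R}.

Let tcons (p : n.-tuple R * R) : n.+1.-tuple R := [tuple of p.2 :: p.1].

Let measurable_tcons : measurable_fun [set: n.-tuple R * R] tcons.
Proof. exact: measurable_cons. Qed.

Definition lebesgue_tuple_cons : set (n.+1.-tuple R) -> \bar R :=
  pushforward (m \x lebesgue_measure)%E tcons.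

Let cons0 : lebesgue_tuple_cons set0 = 0%E.
Proof. exact: measure0. Qed.

Let cons_ge0 A : (0 <= lebesgue_tuple_cons A)%E.
Proof. exact: measure_ge0. Qed.

Let cons_sigma_additive : semi_sigma_additive lebesgue_tuple_cons.
Proof. exact: measure_semi_sigma_additive. Qed.

HB.instance Definition _ := isMeasure.Build _ _ _ lebesgue_tuple_cons
  cons0 cons_ge0 cons_sigma_additive.

End lebesgue_tuple_cons.

(* R^n is n.-tuple R, whose product sigma-algebra is the Borel one.  Lebesgue
   measure on R^n is the n-fold product of Lebesgue measure on R, and
   lebesgue_tuple_box below is the property that characterizes it. *)
Fixpoint lebesgue_tuple (R : realType) (n : nat) :
    {measure set (n.-tuple R) -> \bar R} :=
  match n with
  | 0 => \d_([tuple] : 0.-tuple R)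
  | m.+1 => lebesgue_tuple_cons (lebesgue_tuple R m)
  end.

Lemma lebesgue_tuple_box (R : realType) (n : nat) (A : 'I_n -> set R) :
  (forall i, measurable (A i)) ->
  lebesgue_tuple R n [set t | forall i, A i (tnth t i)] =
  (\prod_(i < n) lebesgue_measure (A i))%E.
Proof.
elim: n A => [|n IH] A mA.
  by rewrite big_ord0 /= diracE mem_set// => -[].
rewrite big_ord_recl /= /lebesgue_tuple_cons /pushforward.
set B := [set t : n.-tuple R | forall i, A (lift ord0 i) (tnth t i)].
rewrite (_ : _ @^-1` _ = B `*` A ord0); last first.
  apply/seteqP; split => [[t x] /= h|[t x] /= [h h0] i].
    split; last exact: (h ord0).
    by move=> i; have := h (lift ord0 i); rewrite tnthS.
  by case: (unliftP ord0 i) => [j|] ->; [rewrite tnthS; exact: h|].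
have mB : measurable B.
  rewrite (_ : B = \bigcap_(i in [set: 'I_n])
      ((fun t : n.-tuple R => tnth t i) @^-1` A (lift ord0 i))); last first.
    by apply/seteqP; split => t h i; [move=> _|]; exact: h.
  apply: fin_bigcap_measurable => // i _.
  by rewrite -[X in measurable X]setTI; exact: measurable_tnth.
rewrite [LHS](product_measure1E (lebesgue_tuple R n) lebesgue_measure
  mB (mA ord0)).
by rewrite muleC /B (IH (fun i => A (lift ord0 i))).
Qed.

(* Densities with respect to Lebesgue measure are everywhere-defined functions,
   since the values of p at individual points are used. *)
Definition has_lebesgue_pdf (R : realType) (d : nat)
    (P : set (d.-tuple R) -> \bar R) (p : d.-tuple R -> R) : Prop :=
  [/\ measurable_fun [set: d.-tuple R] p,
      forall x, 0 <= p x &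
      forall A, measurable A ->
        P A = (\int[lebesgue_tuple R d]_(x in A) (p x)%:E)%E].

Definition posdef_sym (R : realType) (d : nat) (C : 'M[R]_d) : Prop :=
  C^T = C /\ forall v : 'cV[R]_d, v != 0 -> 0 < (v^T *m C *m v) 0 0.

(* The continuous version of the Lebesgue density of N(m, S); it is meaningful
   only for S symmetric positive definite. *)
Definition mvnormal_pdf (R : realType) (d : nat) (m : d.-tuple R) (S : 'M[R]_d)
    (x : d.-tuple R) : R :=
  let v : 'cV[R]_d := \col_i (tnth x i - tnth m i) in
  expR (- (v^T *m invmx S *m v) 0 0 / 2)
    / ((2 * pi) `^ (d%:R / 2) * Num.sqrt (\det S)).

Definition mh_accept (R : realType) (T : Type) (p : T -> R) (q : T -> T -> R)
    (x y : T) : R :=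
  if 0 < p x * q x y then Num.min ((p y * q y x) / (p x * q x y)) 1 else 1.

Definition mh_accept_prob (R : realType) (d : nat) (p : d.-tuple R -> R)
    (q : d.-tuple R -> d.-tuple R -> R) (x : d.-tuple R) : \bar R :=
  (\int[lebesgue_tuple R d]_y (mh_accept p q x y * q x y)%:E)%E.

(* Main.v *)
Require Import Defs.
From HB Require Import structures.
From mathcomp Require Import all_boot all_order all_algebra.
From mathcomp Require Import all_classical all_reals all_analysis.

Import Order.TTheory GRing.Theory Num.Theory.
Import numFieldNormedType.Exports.

Local Open Scope classical_set_scope.
Local Open Scope ring_scope.

(** The accepted flow [p x * a x y * q x y] from [x] to [y] is the smaller of
  the two proposal flows [p x * q x y] and [p y * q y x]; in particular it is
  at most the reverse flow [p y * q y x] ([mh_accept_le]).  If [q y x] never exceeds a constant [M],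
  then [a x y * q x y <= (M / p x) * p y], and integrating over [y] leaves
  [M / p x], because the target density integrates to 1
  ([mh_accept_prob_le]).  For a Gaussian proposal, [M] is the height of the
  density at its mode, that is, its normalizing constant ([mvnormal_pdf_le]);
  pulling [h] out of the determinant of [h *: C] turns this constant into the
  one of the theorem ([gauss_norm_scale]).

  As the drift [mu] is an arbitrary function, [y |-> q y x], and with it the
  integrand of the acceptance probability, may fail to be measurable.  The
  integral of a nonnegative function is a supremum of integrals of simple
  functions below it, hence is monotone all the same ([ge0_le_integral_dom]);
  the dominating function, a multiple of the target density, is measurable,
  and this is what evaluating its integral takes. *)

(** Every simple function below [f] is below [g], so the supremum defining the
  integral of [g] runs over a larger set.  This argument applies to
  integrands that are not measurable. *)
Lemma ge0_le_integral_dom (dd : measure_display) (T : measurableType dd)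
    (R : realType) (m : {measure set T -> \bar R}) (f g : T -> \bar R) :
  (forall x, 0 <= f x)%E -> (forall x, f x <= g x)%E ->
  (\int[m]_x f x <= \int[m]_x g x)%E.
Proof.
move=> f0 fg; have g0 x : (0 <= g x)%E := le_trans (f0 x) (fg x).
rewrite !ge0_integralTE//; apply: ge_ereal_sup => _ [h hf <-].
by apply: ereal_sup_ubound; exists h => // x; exact: le_trans (fg x).
Qed.

(** With the substitution [w = invmx S *m v], the form of [invmx S] at [v] is
  the form of [S] at [w].  A singular [S] is its own [invmx], by
  convention, so it is covered too. *)
Lemma invmx_psd (R : realFieldType) (d : nat) (S : 'M[R]_d) :
  S^T = S -> (forall v : 'cV[R]_d, 0 <= (v^T *m S *m v) 0 0) ->
  forall v : 'cV[R]_d, 0 <= (v^T *m invmx S *m v) 0 0.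
Proof.
move=> symS psdS v; have [uS|nuS] := boolP (S \in unitmx); last first.
  by rewrite invmx_out.
have := psdS (invmx S *m v).
by rewrite trmx_mul trmx_inv symS mulmxKV// mulmxA.
Qed.

Lemma posdef_sym_psd (R : realType) (d : nat) (C : 'M[R]_d) :
  posdef_sym C -> forall v : 'cV[R]_d, 0 <= (v^T *m C *m v) 0 0.
Proof.
move=> [_ pdC] v; have [->|v0] := eqVneq v 0; first by rewrite mulmx0 mxE.
exact/ltW/pdC.
Qed.

Lemma posdef_symZ (R : realType) (d : nat) (h : R) (C : 'M[R]_d) :
  0 < h -> posdef_sym C -> posdef_sym (h *: C).
Proof.
move=> h0 [symC pdC]; split=> [|v v0]; first by rewrite linearZ /= symC.
by rewrite -scalemxAr -scalemxAl mxE mulr_gt0// pdC.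
Qed.

Lemma mvnormal_pdf_ge0 (R : realType) (d : nat) (m : d.-tuple R)
    (S : 'M[R]_d) (x : d.-tuple R) : 0 <= mvnormal_pdf m S x.
Proof.
by rewrite /mvnormal_pdf divr_ge0 ?expR_ge0// mulr_ge0 ?powR_ge0 ?sqrtr_ge0.
Qed.

(** A Gaussian density is largest at its mode, where the exponential is 1. *)
Lemma mvnormal_pdf_le (R : realType) (d : nat) (m : d.-tuple R)
    (S : 'M[R]_d) (x : d.-tuple R) : posdef_sym S ->
  mvnormal_pdf m S x <= ((2 * pi) `^ (d%:R / 2) * Num.sqrt (\det S))^-1.
Proof.
move=> pdS; rewrite /mvnormal_pdf ler_piMl//.
  by rewrite invr_ge0 mulr_ge0 ?powR_ge0 ?sqrtr_ge0.
rewrite expR_le1 mulNr oppr_le0 divr_ge0//.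
exact: (invmx_psd _ _ _ pdS.1 (posdef_sym_psd _ _ _ pdS)).
Qed.

Lemma gauss_norm_scale (R : realType) (d : nat) (h : R) (C : 'M[R]_d) :
  0 < h ->
  (2 * pi) `^ (d%:R / 2) * Num.sqrt (\det (h *: C)) =
  (2 * pi * h) `^ (d%:R / 2) * Num.sqrt (\det C).
Proof.
move=> h0; have hd0 : 0 <= h ^+ d by rewrite exprn_ge0// ltW.
rewrite detZ sqrtrM// -powR12_sqrt// -powR_mulrn ?(ltW h0)// -powRrM mulrA.
by rewrite -powRM ?(ltW h0)// mulr_ge0// pi_ge0.
Qed.

Section acceptance.
Context {R : realType}.

Lemma mh_accept_ge0 (T : Type) (p : T -> R) (q : T -> T -> R) (x y : T) :
  (forall z, 0 <= p z) -> (forall z w, 0 <= q z w) -> 0 <= mh_accept p q x y.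
Proof.
move=> p0 q0; rewrite /mh_accept; case: ifP => // _.
by rewrite le_min ler01 andbT divr_ge0 ?mulr_ge0.
Qed.

(** If the proposal flow from [x] to [y] exceeds the reverse one, the
  acceptance ratio cuts it down to the reverse flow; otherwise it is already
  the smaller of the two.  A flow [q x y = 0] falls in the second case. *)
Lemma mh_accept_le (T : Type) (p : T -> R) (q : T -> T -> R) (x y : T) :
  (forall z, 0 <= p z) -> (forall z w, 0 <= q z w) -> 0 < p x ->
  mh_accept p q x y * q x y <= p y * q y x / p x.
Proof.
move=> p0 q0 px; have rhs0 : 0 <= p y * q y x / p x.
  by rewrite divr_ge0 ?mulr_ge0.
rewrite /mh_accept pmulr_rgt0//; case: ltP => [qxy|qxy]; last first.
  by rewrite mul1r (le_trans qxy).
apply: (@le_trans _ _ (p y * q y x / (p x * q x y) * q x y)).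
  by rewrite ler_wpM2r// ge_min lexx.
by rewrite invfM mulrA mulfVK// gt_eqF.
Qed.

(** A bound on the reverse proposal density [q y x] that is uniform in [y]
  makes the integrand at most a multiple of the target density, whose
  integral is the total mass of [Pi]. *)
Lemma mh_accept_prob_le (d : nat) (Pi : probability (d.-tuple R) R)
    (p : d.-tuple R -> R) (q : d.-tuple R -> d.-tuple R -> R) (M : R)
    (x : d.-tuple R) :
  has_lebesgue_pdf Pi p -> (forall z w, 0 <= q z w) ->
  (forall y, q y x <= M) -> 0 < p x ->
  (mh_accept_prob p q x <= (M / p x)%:E)%E.
Proof.
move=> [mp p0 PiE] q0 qM px; have M0 : 0 <= M := le_trans (q0 x x) (qM x).
have -> : (M / p x)%:E = (\int[lebesgue_tuple R d]_y ((M / p x)%:E * (p y)%:E))%E.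
  rewrite ge0_integralZl_EFin//.
  - by rewrite -PiE// probability_setT mule1.
  - by move=> y _; rewrite lee_fin.
  - exact/measurable_realfun.measurable_EFinP.
  - by rewrite divr_ge0.
apply: ge0_le_integral_dom => y.
  by rewrite lee_fin mulr_ge0// mh_accept_ge0.
rewrite -EFinM lee_fin (le_trans (mh_accept_le _ _ _ _ _ p0 q0 px))//.
by rewrite [leRHS]mulrAC ler_wpM2r ?invr_ge0// mulrC ler_wpM2r.
Qed.

End acceptance.

Theorem proposition5 (R : realType) (d : nat)
    (Pi : probability (d.-tuple R) R) (p : d.-tuple R -> R)
    (Theta : set (d.-tuple R))
    (h : R) (C : 'M[R]_d) (mu : d.-tuple R -> d.-tuple R)
    (theta0 : d.-tuple R)
    (Pi_density : has_lebesgue_pdf Pi p)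
    (ThetaE : forall theta, 0 < p theta <-> Theta theta)
    (h_gt0 : 0 < h)
    (C_posdef : posdef_sym C)
    (Theta_theta0 : Theta theta0) :
  (mh_accept_prob p (fun theta => mvnormal_pdf (mu theta) (h *: C)) theta0
   <= (1 / (p theta0 * (2 * pi * h) `^ (d%:R / 2) * Num.sqrt (\det C)))%:E)%E.
Proof.
rewrite div1r -mulrA -gauss_norm_scale// invfM mulrC.
apply: mh_accept_prob_le Pi_density _ _ _.
- by move=> z w; exact: mvnormal_pdf_ge0.
- by move=> y; exact/mvnormal_pdf_le/posdef_symZ.
- exact/ThetaE.
Qed.
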